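(* Suppose that the oracle scores $S^1,S^2$ of the test and calibration data follow the two-class mixture model described in the context, and let $\alpha$ be a level chosen in advance. Let $D_\alpha$ be the set of selection rules $\delta=(\delta^j)_{j\in D^{test}}\in\{0,1,2\}^{n^{test}}$ that satisfy $\mathrm{mFSR}\le\alpha$, and let $\mathrm{ETS}_\delta$ denote the ETS of a selection rule $\delta$. Let $\delta_{OR}$ be the oracle rule $$\delta^j_{OR}=\Big(\arg\max_{i\in\{1,2\}} S^i(X_j)\Big)\cdot \mathbb I\big(S(X_j)\ge Q^{-1}(\alpha)\big),\qquad j\in D^{test}.$$ Then $\delta_{OR}$ is optimal in the sense that $\mathrm{ETS}_{\delta_{OR}}\ge \mathrm{ETS}_{\delta}$ for every $\delta\in D_\alpha$ and every finite sample size $n^{test}$.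
   Context: Binary selective classification. Each sample is a pair $(X,Y)$ with feature vector $X\in\mathbb R^p$ and true class $Y\in\{1,2\}$. There is a labeled calibration set $D^{cal}$ of size $n^{cal}$ and a test set $D^{test}$ of size $n^{test}$ whose labels are not observed; $j\in D^{test}$ means that sample $j$ is in the test set. A selection rule $\delta$ assigns to each test sample, on the basis of the test features, a prediction $\hat Y_j=\delta^j\in\{0,1,2\}$, where $0$ means ''indecision''. Oracle scores: $S^i(x)=P(Y=i\mid X=x)$, $i=1,2$, so $S^1+S^2=1$; and $S(x)=\max\{S^1(x),S^2(x)\}$. Mixture model: in the test data $S^i\sim \pi_{test}F^i_1+(1-\pi_{test})F^i_2$ and in the calibration data $S^i\sim\pi_{cal}F^i_1+(1-\pi_{cal})F^i_2$, $i=1,2$, where $\pi_{test},\pi_{cal}$ are the probabilities of class 1 in the test and calibration data, and $F^j_k$ is the conditional CDF of $S^j(X)$ given $Y=k$, with density $f^j_k$. For a selection rule with predictions $\hat Y_j$, $$\mathrm{mFSR}=\frac{\mathbb E\{\sum_{j\in D^{test}}\mathbb I(\hat Y_j\ne Y_j,\hat Y_j\neq 0)\}}{\mathbb E\{\sum_{j\in D^{test}}\mathbb I(\hat Y_j\ne 0)\}},\qquad \mathrm{ETS}=\mathbb E\Big\{\sum_{j\in D^{test}}\mathbb I(\hat Y_j=Y_j,\hat Y_j\ne0)\Big\}.$$ For a threshold $t$, with $S_j=S(X_j)$, $$Q(t)=\frac{\mathbb E\{\sum_{j\in D^{test}}(1-S_j)\mathbb I(S_j\ge t)\}}{\mathbb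 E\{\sum_{j\in D^{test}}\mathbb I(S_j\ge t)\}},$$ which is the mFSR of the rule $\arg\max_i S^i(X_j)\cdot\mathbb I(S_j\ge t)$. $Q$ is monotonically decreasing, and $Q^{-1}(\alpha)$ denotes the corresponding threshold $t$ with $Q(t)=\alpha$ (taken to exist).
   Formalization: The test samples (X_j, Y_j) are assumed mutually independent, which the statement leaves unsaid; without it a rule using the other samples' features can beat the oracle rule. *)

(* Defs.v *)
From HB Require Import structures.
From mathcomp Require Import all_boot all_order all_algebra.
From mathcomp Require Import all_classical all_reals all_analysis.

Set Implicit Arguments.
Unset Strict Implicit.
Unset Printing Implicit Defensive.

Import Order.TTheory GRing.Theory Num.Theory.

Local Open Scope classical_set_scope.
Local Open Scope ring_scope.

(* R^p is p.-tuple R with its product (Borel) sigma-algebra.  Labels and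
   predictions are natural numbers: the classes are 1 and 2, the value 0 is
   the indecision. *)
Definition is_class (k : nat) : bool := (k == 1%N) || (k == 2%N).

Section Probability.
Context d (T : measurableType d) (R : realType) (P : probability T R).

(* Real-valued expectation; all the variables below are bounded. *)
Definition Exp (Z : T -> R) : R := fine 'E_P[Z].

Definition cprob (A B : set T) : R := fine (P (A `&` B)) / fine (P B).

(* Events may be setT, so the product rule over the whole finite family gives
   the product rule over every subfamily. *)
Definition mutually_independent d' (U : measurableType d') (n : nat)
    (Z : 'I_n -> T -> U) : Prop :=
  forall B : 'I_n -> set U, (forall j, measurable (B j)) ->
    P [set w | forall j, B j (Z j w)] = (\prod_(j < n) P (Z j @^-1` B j))%E.

(* S is a version of the conditional class probabilities
   S i x = P(Y = i | X = x), normalized at every point x. *)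
Record is_oracle_score p (X : {RV P >-> p.-tuple R}) (Y : {RV P >-> nat})
    (S : nat -> {mfun p.-tuple R >-> R}) : Prop := IsOracleScore {
  oracle_score_ge0 : forall i x, is_class i -> 0 <= S i x ;
  oracle_score_sum : forall x, S 1%N x + S 2%N x = 1 ;
  oracle_scoreE : forall i (B : set (p.-tuple R)),
    is_class i -> measurable B ->
    P (X @^-1` B `&` Y @^-1` [set i]) =
    (\int[P]_(w in X @^-1` B) (S i (X w))%:E)%E }.

(* The scores of the labeled sample (X, Y) follow the two-class mixture with
   weight pi of class 1 and class-conditional distribution functions
   F i k (of S i given Y = k). *)
Record follows_mixture p (X : {RV P >-> p.-tuple R}) (Y : {RV P >-> nat})
    (S : nat -> {mfun p.-tuple R >-> R}) (pi : R) (F : nat -> nat -> R -> R)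
    : Prop := FollowsMixture {
  mixture_class : forall w, is_class (Y w) ;
  mixture_prior : P (Y @^-1` [set 1%N]) = pi%:E ;
  mixture_cond : forall i k s, is_class i -> is_class k ->
    P (Y @^-1` [set k]) != 0%E ->
    cprob [set w | S i (X w) <= s] (Y @^-1` [set k]) = F i k s ;
  mixture_cdf : forall i s, is_class i ->
    cdf (S i \o X : {RV P >-> R}) s =
    (pi * F i 1%N s + (1 - pi) * F i 2%N s)%:E }.

End Probability.

Record has_density (R : realType) (F f : R -> R) : Prop := HasDensity {
  density_measurable : measurable_fun setT f ;
  density_ge0 : forall x, 0 <= f x ;
  density_int1 : (\int[lebesgue_measure]_x (f x)%:E = 1)%E ;
  density_cdf : forall s,
    (\int[lebesgue_measure]_(x in `]-oo, s]) (f x)%:E = (F s)%:E)%E }.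

Section Scores.
Context (R : realType) (p : nat) (S : nat -> {mfun p.-tuple R >-> R}).

Definition max_score (x : p.-tuple R) : R := Num.max (S 1%N x) (S 2%N x).

(* Ties are broken in favour of class 1; a tie means S 1 x = 1/2, a null event
   when the score distributions have densities. *)
Definition argmax_class (x : p.-tuple R) : nat :=
  if S 2%N x <= S 1%N x then 1%N else 2%N.

End Scores.

Section Selection.
Context (R : realType) (p n : nat).

(* The prediction for test sample j is a function of all test features. *)
Definition rule := 'I_n -> n.-tuple (p.-tuple R) -> nat.

Definition selection_rule (delta : rule) : Prop :=
  forall j, measurable_fun setT (delta j) /\ forall x, (delta j x <= 2)%N.

Definition oracle_rule (S : nat -> {mfun p.-tuple R >-> R}) (t : R) : rule :=
  fun j x =>
    (argmax_class S (tnth x j) * (t <= max_score S (tnth x j))%R)%N.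

Context d (T : measurableType d) (P : probability T R).
Context (X : 'I_n -> {RV P >-> p.-tuple R}) (Y : 'I_n -> {RV P >-> nat}).

Definition prediction (delta : rule) (j : 'I_n) (w : T) : nat :=
  delta j [tuple X i w | i < n].

(* As 0 / 0 = 0, a rule that almost surely never selects has mFSR 0; the same
   convention applies to Q below. *)
Definition mFSR (delta : rule) : R :=
  Exp P (fun w => \sum_(j < n)
    ((prediction delta j w != Y j w) && (prediction delta j w != 0%N))%:R) /
  Exp P (fun w => \sum_(j < n) (prediction delta j w != 0%N)%:R).

Definition ETS (delta : rule) : R :=
  Exp P (fun w => \sum_(j < n)
    ((prediction delta j w == Y j w) && (prediction delta j w != 0%N))%:R).

Definition Q (S : nat -> {mfun p.-tuple R >-> R}) (t : R) : R :=
  Exp P (fun w => \sum_(j < n)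
    (1 - max_score S (X j w)) * (t <= max_score S (X j w))%R%:R) /
  Exp P (fun w => \sum_(j < n) (t <= max_score S (X j w))%R%:R).

Definition D (alpha : R) : set rule :=
  [set delta | selection_rule delta /\ mFSR delta <= alpha].

End Selection.

(* Main.v *)
Require Import Defs.
From HB Require Import structures.
From mathcomp Require Import all_boot all_order all_algebra.
From mathcomp Require Import all_classical all_reals all_analysis.
From mathcomp Require Import measurable_realfun.
From mathcomp Require Import ring lra.

(* By independence of the samples and the definition of the scores, the
   indicator of a correct selection of sample j may be replaced in expectations
   by the score S^k(X_j) of the predicted class k.  So, with N the expected
   number of selections, mFSR = (N - ETS) / N, and Q(t) is the mFSR of the
   oracle rule.  The oracle maximizes ETS - t N pointwise; with
   N - ETS <= alpha N, and equality for the oracle, this gives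
   (1 - alpha - t) ETS <= (1 - alpha - t) ETS_OR when t > 0 (for t <= 0 the
   oracle classifies every sample).  The factor is positive if the oracle selects
   with positive probability, since otherwise all its selected scores would equal
   t although the densities make the scores atomless.  If the oracle almost never
   selects, then alpha = 0, and for t >= 1 every rule satisfying mFSR <= 0 almost
   never selects, again because the scores are atomless. *)

Set Implicit Arguments.
Unset Strict Implicit.
Unset Printing Implicit Defensive.

Import Order.TTheory GRing.Theory Num.Theory.
Import numFieldNormedType.Exports.

Local Open Scope classical_set_scope.
Local Open Scope ring_scope.

(** * Measures given by a density, and absence of atoms for the scores *)

Section DensityMeasure.
Context d (T : measurableType d) (R : realType) (mu : {measure set T -> \bar R}).
Variables (f : T -> R) (f_ge0 : forall x, 0 <= f x).
Hypothesis mf : measurable_fun setT f.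

(** The two proofs are arguments so that the measure structure can be inferred from the term
    itself. *)
Definition density_measure of (forall x, 0 <= f x) & measurable_fun setT f :=
  fun A : set T => (\int[mu]_(x in A) (f x)%:E)%E.

Local Notation nu := (density_measure f_ge0 mf).

Let nu0 : nu set0 = 0%E.
Proof. exact: integral_set0. Qed.

Let nu_ge0 A : (0 <= nu A)%E.
Proof. by apply: integral_ge0 => x _; rewrite lee_fin. Qed.

Let nu_sigma_additive : semi_sigma_additive nu.
Proof.
move=> A mA tA mUA; rewrite /density_measure ge0_integral_bigcup//; last 2 first.
- by apply/measurable_EFinP; exact: measurable_funTS.
- by move=> x _; rewrite lee_fin.
by apply: is_cvg_ereal_nneg_natsum => n _; exact: nu_ge0.
Qed.

HB.instance Definition _ := isMeasure.Build _ _ _ nu nu0 nu_ge0 nu_sigma_additive.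

End DensityMeasure.

(** The closed half-lines ending at [c - n.+1%:R^-1] increase to the open half-line ending at [c],
    so continuity from below of the measure with density [f] applies. *)
Lemma has_density_left_cvg (R : realType) (F f : R -> R) (c : R) :
  has_density F f -> F (c - n.+1%:R^-1) @[n --> \oo] --> F c.
Proof.
case=> mf f0 _ Ff.
have mEf (A : set R) : measurable_fun A (EFin \o f).
  by apply/measurable_EFinP; exact: measurable_funTS.
pose nu : {measure set _ -> \bar R} := density_measure (@lebesgue_measure R) f0 mf.
pose I n := `]-oo, c - n.+1%:R^-1]%classic : set R.
have UI : \bigcup_n I n = `]-oo, c[%classic.
  apply/seteqP; split => x /=.
    move=> [n _]; rewrite /I /= !in_itv/= => /le_lt_trans; apply.
    by rewrite ltrBlDr ltrDl invr_gt0.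
  rewrite in_itv/= => xc.
  (* Any [n] with 1/(n+1) < c - x puts [x] in [I n]. *)
  have /cvgrPdist_lt /(_ (c - x)) := @cvg_harmonic R.
  rewrite subr_gt0 => /(_ xc)[n _ /(_ _ (leqnn n))]/=.
  rewrite sub0r normrN ger0_norm ?invr_ge0// => h.
  by exists n => //; rewrite /I /= in_itv/= lerBrDr -lerBrDl ltW.
have : nu \o I @ \oo --> nu (\bigcup_n I n).
  apply: nondecreasing_cvg_mu; first by move=> n; exact: measurable_itv.
    by rewrite UI; exact: measurable_itv.
  move=> m n mn; apply/subsetPset => x; rewrite /I/= !in_itv/= => /le_trans; apply.
  by rewrite lerB// lef_pV2 ?posrE// ler_nat.
(* Lebesgue measure does not charge [c], so the open half-line also has mass [F c]. *)
rewrite UI {2}/nu/= /density_measure integral_itv_bndo_bndc// Ff.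
move=> /fine_cvgP[_]; apply: cvg_trans; apply: near_eq_cvg.
by apply: nearW => n; rewrite /= /nu/= /density_measure Ff.
Qed.

(** The event that the score is [c] lies in the event that it falls between c - 1/(n+1), excluded,
    and [c]. The probability of the latter is an increment of the mixture distribution function [G],
    which tends to 0 because both components are left continuous. *)
Lemma score_atomless d (T : measurableType d) (R : realType)
  (P : probability T R) p (X : {RV P >-> p.-tuple R}) (Y : {RV P >-> nat})
  (S : nat -> {mfun p.-tuple R >-> R}) (pi : R) (F f : nat -> nat -> R -> R) :
  follows_mixture X Y S pi F ->
  (forall i k, is_class i -> is_class k -> has_density (F i k) (f i k)) ->
  forall i c, is_class i -> P ((S i \o X) @^-1` [set c]) = 0%E.
Proof.
move=> [_ _ _ mixture] density i c ci.
set Z := (S i \o X : {RV P >-> R}).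
have mZ (A : set R) : measurable A -> measurable (Z @^-1` A).
  exact: measurable_funPTI.
pose G s := pi * F i 1%N s + (1 - pi) * F i 2%N s.
have ZG s : P (Z @^-1` `]-oo, s]) = (G s)%:E.
  by have := mixture i s ci; rewrite /cdf /distribution/= /pushforward => <-.
have Gcvg : G (c - n.+1%:R^-1) @[n --> \oo] --> G c.
  by apply: cvgD; apply: cvgM; (exact: cvg_cst || apply: has_density_left_cvg (density _ _ _ _)).
have le0 n : (P (Z @^-1` [set c]) <= (G c - G (c - n.+1%:R^-1))%:E)%E.
  have lt_c : c - n.+1%:R^-1 < c by rewrite ltrBlDr ltrDl invr_gt0.
  have sub : Z @^-1` `]-oo, c - n.+1%:R^-1] `<=` Z @^-1` `]-oo, c].
    by move=> w /=; rewrite !in_itv/= => /le_trans; apply; exact: ltW.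
  rewrite EFinB -!ZG -(setIidr sub) -measureD; last 3 first.
  - exact: mZ.
  - exact: mZ.
  - by rewrite -ge0_fin_numE// fin_num_measure//; exact: mZ.
  apply: le_measure; rewrite ?inE.
  - exact: mZ.
  - by apply: measurableD; exact: mZ.
  - by move=> w /= Zw; rewrite /= !in_itv/= Zw lexx leNgt lt_c.
have fP : P (Z @^-1` [set c]) \is a fin_num by exact: fin_num_measure (mZ _ _).
apply/eqP; rewrite eq_le measure_ge0 andbT -(fineK fP) lee_fin.
have -> : 0 = lim ((G c - G (c - n.+1%:R^-1)) @[n --> \oo]).
  apply/esym/cvg_lim => //; rewrite -(subrr (G c)).
  by apply: cvgB => //; exact: cvg_cst.
apply: limr_ge.
  by apply: is_cvgB; [exact: is_cvg_cst|apply: cvgP Gcvg].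
by apply: nearW => n; rewrite -lee_fin fineK.
Qed.

(** * Restricted measures and measurable rectangles *)

Lemma ge0_integral_mrestr d (T : measurableType d) (R : realType)
  (mu : {measure set T -> \bar R}) (A D : set T) (mA : measurable A)
  (f : T -> \bar R) :
  measurable D -> measurable_fun D f -> (forall x, D x -> (0 <= f x)%E) ->
  (\int[mrestr mu mA]_(x in D) f x = \int[mu]_(x in D `&` A) f x)%E.
Proof.
move=> mD mf f0; rewrite (@ge0_negligible_integral _ _ _ _ D (~` A))//.
- rewrite setDE setCK; apply: eq_measure_integral => B mB BA.
  by rewrite /= /mrestr setIidl// => x /BA[].
- exact: measurableC.
- by rewrite /= /mrestr setICl measure0.
Qed.

Section Rectangles.
Context d (U : measurableType d) (n : nat).

Definition rectangles : set (set (n.-tuple U)) :=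
  [set A | exists2 B : 'I_n -> set U, (forall i, measurable (B i)) &
    A = [set x | forall i, B i (tnth x i)]].

Lemma setI_closed_rectangles : setI_closed rectangles.
Proof.
move=> _ _ [B mB ->] [C mC ->]; exists (fun i => B i `&` C i).
  by move=> i; exact: measurableI.
by apply/seteqP; split=> x /= => [[HB HC] i|H]; [split|split=> i; case: (H i)].
Qed.

Lemma rectanglesT : rectangles setT.
Proof. by exists (fun=> setT) => //; apply/seteqP; split. Qed.

Lemma measurable_forall_ord d' (T : measurableType d') (B : 'I_n -> set T) :
  (forall i, measurable (B i)) -> measurable [set x | forall i, B i x].
Proof.
move=> mB; rewrite (_ : [set _ | _] = \bigcap_(i in [set: 'I_n]) B i); last first.
  by apply/seteqP; split=> x /= H i; [move=> _; exact: H|exact: H].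
by apply: fin_bigcap_measurable => // i _; exact: mB.
Qed.

(** A preimage under one coordinate is a rectangle whose other sides are full; conversely, a
    rectangle is a finite intersection of such preimages. *)
Lemma measurable_rectangles : @measurable _ (n.-tuple U) = <<s rectangles >>.
Proof.
apply/seteqP; split.
  apply: smallest_sub; first exact: smallest_sigma_algebra.
  apply: (big_ind (fun G => G `<=` <<s rectangles >>)) => //=.
    by move=> G H GR HR A [/GR|/HR].
  move=> i _ _ [A mA <-]; apply: sub_sigma_algebra.
  exists (fun k => if k == i then A else setT); first by move=> k; case: ifP.
  rewrite setTI; apply/seteqP; split=> x /=; last by move=> /(_ i); rewrite eqxx.
  by move=> Ax k; case: eqP => // ->.
apply: smallest_sub; first exact: sigma_algebra_measurable.
move=> _ [B mB ->]; apply: (@measurable_forall_ord _ _ (fun i => (@tnth n U ^~ i) @^-1` B i)).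
move=> i; rewrite -[X in measurable X]setTI; exact: measurable_tnth.
Qed.

End Rectangles.

(** * From the score given one feature vector to the score given all of them *)

Section Independence.
Context d (T : measurableType d) (R : realType) (P : probability T R).
Context d' (U : measurableType d') (n : nat).
Variables (X : 'I_n -> {RV P >-> U}) (Y : 'I_n -> {RV P >-> nat}).
Hypothesis indep : mutually_independent P (fun j w => (X j w, Y j w)).
Variable j : 'I_n.

Let others (B : 'I_n -> set U) := [set w | forall i, i != j -> B i (X i w)].

Let measurable_others B : (forall i, measurable (B i)) -> measurable (others B).
Proof.
move=> mB; rewrite (_ : others B =
  [set w | forall i, (if i == j then setT else X i @^-1` B i) w]).
  by apply: measurable_forall_ord => i; case: ifP => // _; exact: measurable_funPTI.
by apply/seteqP; split=> w /= H i; have := H i; case: eqP => //= _; apply.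
Qed.

(** The left-hand event is a product event for the pairs (X i, Y i), with no constraint on the
    labels of the other samples, so the product rule isolates the factor of sample [j]. *)
Lemma independent_others (B : 'I_n -> set U) (D : set U) (C : set nat) :
  (forall i, measurable (B i)) -> measurable D ->
  P (others B `&` (X j @^-1` D `&` Y j @^-1` C)) =
  (P (others B) * P (X j @^-1` D `&` Y j @^-1` C))%E.
Proof.
move=> mB mD.
have H (D' : set U) (C' : set nat) : measurable D' ->
    P (others B `&` (X j @^-1` D' `&` Y j @^-1` C')) =
    (P (X j @^-1` D' `&` Y j @^-1` C') * \prod_(i < n | i != j) P (X i @^-1` B i))%E.
  move=> mD'.
  pose E i := (if i == j then D' else B i) `*` (if i == j then C' else setT).
  rewrite (_ : _ `&` _ = [set w | forall i, E i (X i w, Y i w)]).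
    rewrite indep; last by move=> i; apply: measurableX => //; case: ifP.
    rewrite (bigD1 j)//= /E eqxx; congr (_ * _)%E.
    apply: eq_bigr => i /negbTE ij; rewrite ij.
    by congr (P _); apply/seteqP; split=> w //= -[].
  apply/seteqP; split=> w /=.
    by move=> [Hw [Dw Cw]] i; rewrite /E; have := Hw i; case: eqP => [->|_ /(_ isT)].
  move=> Hw; split; last by have := Hw j; rewrite /E eqxx.
  by move=> i /negbTE ij; have [] := Hw i; rewrite /E ij.
rewrite H// muleC; congr (_ * _)%E.
(* With sample [j] unconstrained, the same formula identifies the remaining product as
   [P (others B)]. *)
have := H setT setT measurableT.
by rewrite !preimage_setT !setIT probability_setT mul1e => ->.
Qed.

Variables (k : nat) (s : {mfun U >-> R}).
Hypothesis s_ge0 : forall x, 0 <= s x.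
Hypothesis sE : forall B, measurable B ->
  (P (X j @^-1` B `&` Y j @^-1` [set k]) = \int[P]_(w in X j @^-1` B) (s (X j w))%:E)%E.

Let mEs D : measurable_fun D (EFin \o s).
Proof. by apply/measurable_EFinP; exact: measurable_funTS. Qed.

(** By independence, the law of [X j] under [P] restricted to [others B] is [P (others B)] times its
    law under [P]; both sides integrate [s] against this measure over [D]. *)
Lemma integral_others (B : 'I_n -> set U) (D : set U) :
  (forall i, measurable (B i)) -> measurable D ->
  (\int[P]_(w in X j @^-1` D `&` others B) (s (X j w))%:E =
   P (others B) * \int[P]_(w in X j @^-1` D) (s (X j w))%:E)%E.
Proof.
move=> mB mD.
have mA := measurable_others mB.
have mX : measurable_fun setT (X j) by [].
have mXs E : measurable_fun E (fun w => (s (X j w))%:E).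
  apply/measurable_EFinP; apply: measurable_funTS.
  exact: measurableT_comp.
have Es_ge0 x : (0 <= (EFin \o s) x)%E by rewrite lee_fin.
have Es0 : {in D, forall x, (0 <= (EFin \o s) x)%E} by move=> x _.
rewrite -(ge0_integral_mrestr P mA)//; [|exact: measurable_funPTI|by move=> x _; rewrite lee_fin].
rewrite -(@ge0_integral_pushforward _ _ _ _ _ _ mX _ D (EFin \o s) mD (@mEs D) Es0).
rewrite -[in RHS](@ge0_integral_pushforward _ _ _ _ _ _ mX _ D (EFin \o s) mD (@mEs D) Es0).
have fA : 0 <= fine (P (others B)) by exact: fine_ge0.
rewrite -(fineK (fin_num_measure P _ mA)).
rewrite -[in RHS](ge0_integral_mscale (distribution P (X j)) mD (NngNum fA)
  (@mEs D) (fun x _ => Es_ge0 x)).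
apply: eq_measure_integral => E mE _.
have := independent_others setT mB mE; rewrite preimage_setT setIT.
by rewrite /= /pushforward /mscale /mrestr /= fineK ?fin_num_measure// setIC.
Qed.

(** Both sides are measures in [B]. They agree on rectangles by independence, rectangles are closed
    under intersection and generate the sigma-algebra, and the total mass is finite, so the measures
    coincide. *)
Lemma joint_score (B : set (n.-tuple U)) : measurable B ->
  let XT := fun w => [tuple X i w | i < n] in
  (P (XT @^-1` B `&` Y j @^-1` [set k]) =
   \int[P]_(w in XT @^-1` B) (s (X j w))%:E)%E.
Proof.
move=> mB XT.
have mXT : measurable_fun setT XT.
  apply/measurable_fun_tnthP => i.
  rewrite (_ : _ \o _ = X i)//; apply/funext => w; exact: tnth_mktuple.
have mYk : measurable (Y j @^-1` [set k]) by exact: measurable_funPTI.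
have mXs : measurable_fun setT (fun w => s (X j w)).
  exact: measurableT_comp.
pose PY : {measure set T -> \bar R} := mrestr P mYk.
pose Ps : {measure set T -> \bar R} := density_measure P (fun w => s_ge0 (X j w)) mXs.
pose push (Q : {measure set T -> \bar R}) : {measure set (n.-tuple U) -> \bar R} :=
  pushforward Q XT.
pose m1 := push mXT PY.
pose m2 := push mXT Ps.
rewrite -[LHS]/(m1 B) -[RHS]/(m2 B).
apply: (measure_unique (@rectangles _ U n) (fun=> setT)) => //.
- exact: measurable_rectangles.
- exact: setI_closed_rectangles.
- by move=> _; exact: rectanglesT.
- by apply/seteqP; split=> // x _; exists 0%N.
- move=> _ [C mC ->]; rewrite /m1 /m2 /push /PY /Ps /= /pushforward /= /mrestr /density_measure.
  rewrite (_ : XT @^-1` _ = X j @^-1` C j `&` others C); last first.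
    apply/seteqP; split=> w /=.
      by move=> H; split => [|i _]; [have := H j|have := H i]; rewrite tnth_mktuple.
    by move=> [Hj Ho] i; rewrite tnth_mktuple; have [->//|/Ho] := eqVneq i j.
  by rewrite integral_others// -sE// -independent_others// setIAC setIC.
- move=> _; rewrite /m1 /push /PY /= /pushforward /= /mrestr.
  by rewrite preimage_setT setTI -ge0_fin_numE// fin_num_measure.
Qed.

End Independence.

(** * Expectations of bounded random variables *)

Section BoundedExpectation.
Context d (T : measurableType d) (R : realType) (P : probability T R).
Implicit Types Z W : T -> R.

(** Enough for integrability under a probability, and stable under sums and products. *)
Definition bounded_measurable Z :=
  measurable_fun setT Z /\ exists M, forall w, `|Z w| <= M.

Lemma bounded_measurable_cst (c : R) : bounded_measurable (fun=> c).
Proof. by split=> //; exists `|c|. Qed.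

Lemma bounded_measurableD Z W : bounded_measurable Z -> bounded_measurable W ->
  bounded_measurable (fun w => Z w + W w).
Proof.
move=> [mZ [M ZM]] [mW [N WN]]; split; first exact: measurable_funD.
by exists (M + N) => w; rewrite (le_trans (ler_normD _ _))// lerD.
Qed.

Lemma bounded_measurableM Z W : bounded_measurable Z -> bounded_measurable W ->
  bounded_measurable (fun w => Z w * W w).
Proof.
move=> [mZ [M ZM]] [mW [N WN]]; split; first exact: measurable_funM.
by exists (M * N) => w; rewrite normrM ler_pM.
Qed.

Lemma bounded_measurableB Z W : bounded_measurable Z -> bounded_measurable W ->
  bounded_measurable (fun w => Z w - W w).
Proof.
move=> [mZ [M ZM]] [mW [N WN]]; split; first exact: measurable_funB.
by exists (M + N) => w; rewrite (le_trans (ler_normB _ _))// lerD.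
Qed.

Lemma bounded_measurable_norm Z : bounded_measurable Z ->
  bounded_measurable (fun w => `|Z w|).
Proof.
move=> [mZ [M ZM]]; split; first exact: measurableT_comp.
by exists M => w; rewrite normr_id.
Qed.

Lemma bounded_measurable_sum (I : Type) (r : seq I) (Z : I -> T -> R) :
  (forall j, bounded_measurable (Z j)) ->
  bounded_measurable (fun w => \sum_(j <- r) Z j w).
Proof.
move=> bZ; elim: r => [|i r IHr].
  by under eq_fun do rewrite big_nil; exact: bounded_measurable_cst.
by under eq_fun do rewrite big_cons; exact: bounded_measurableD.
Qed.

Lemma bounded_measurable_indic (A : set T) : measurable A ->
  bounded_measurable \1_A.
Proof.
move=> mA; split; first exact: measurable_indic.
by exists 1 => w; rewrite indicE; case: (_ \in _); rewrite ?normr1 ?normr0.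
Qed.

Lemma bounded_measurable_integrable Z : bounded_measurable Z ->
  P.-integrable setT (EFin \o Z).
Proof.
move=> [mZ [M ZM]]; apply: measurable_bounded_integrable => //.
  by rewrite -ge0_fin_numE// fin_num_measure.
by exists M; split=> [|x Mx w _]; [exact: num_real|exact: le_trans (ZM w) (ltW Mx)].
Qed.

Lemma ExpE Z : Exp P Z = \int[P]_w Z w.
Proof. by rewrite /Exp unlock. Qed.

Lemma ExpD Z W : bounded_measurable Z -> bounded_measurable W ->
  Exp P (fun w => Z w + W w) = Exp P Z + Exp P W.
Proof.
by move=> bZ bW; rewrite !ExpE RintegralD//; exact: bounded_measurable_integrable.
Qed.

Lemma ExpB Z W : bounded_measurable Z -> bounded_measurable W ->
  Exp P (fun w => Z w - W w) = Exp P Z - Exp P W.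
Proof.
by move=> bZ bW; rewrite !ExpE RintegralB//; exact: bounded_measurable_integrable.
Qed.

Lemma ExpZ c Z : bounded_measurable Z ->
  Exp P (fun w => c * Z w) = c * Exp P Z.
Proof.
by move=> bZ; rewrite !ExpE RintegralZl//; exact: bounded_measurable_integrable.
Qed.

Lemma le_Exp Z W : bounded_measurable Z -> bounded_measurable W ->
  (forall w, Z w <= W w) -> Exp P Z <= Exp P W.
Proof.
by move=> bZ bW ZW; rewrite !ExpE le_Rintegral//; exact: bounded_measurable_integrable.
Qed.

Lemma Exp_ge0 Z : (forall w, 0 <= Z w) -> 0 <= Exp P Z.
Proof. by move=> Z0; rewrite ExpE Rintegral_ge0. Qed.

Lemma Exp_sum (I : Type) (r : seq I) (Z : I -> T -> R) :
  (forall j, bounded_measurable (Z j)) ->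
  Exp P (fun w => \sum_(j <- r) Z j w) = \sum_(j <- r) Exp P (Z j).
Proof.
move=> bZ; elim: r => [|i r IHr].
  by under eq_fun do rewrite big_nil; rewrite big_nil ExpE Rintegral_cst// mul0r.
under eq_fun do rewrite big_cons; rewrite big_cons -IHr ExpD//.
exact: bounded_measurable_sum.
Qed.

(** A nonnegative variable with nonpositive expectation vanishes almost everywhere; the almost sure
    event [A] is where this forces [W] to vanish too. *)
Lemma Exp_eq0 (A : set T) Z W : bounded_measurable Z -> bounded_measurable W ->
  (forall w, 0 <= Z w) -> Exp P Z <= 0 -> {ae P, forall w, A w} ->
  (forall w, A w -> Z w = 0 -> W w = 0) -> Exp P W = 0.
Proof.
move=> bZ bW Z0 EZ aeA ZW.
have mE V : bounded_measurable V -> measurable_fun setT (EFin \o V).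
  by case=> mV _; exact/measurable_EFinP.
have iZ := bounded_measurable_integrable bZ.
have Zae : ae_eq P setT (EFin \o Z) (cst 0%E).
  apply/ae_eq_integral_abs => //; first exact: mE.
  under eq_integral do rewrite /= ger0_norm//.
  apply/eqP; rewrite eq_le integral_ge0 ?andbT; last by move=> w _; rewrite lee_fin.
  have f := integrable_fin_num measurableT iZ.
  by rewrite -(fineK f) lee_fin; move: EZ; rewrite ExpE.
rewrite ExpE /Rintegral (ae_eq_integral (cst 0%E))//.
- by rewrite integral0.
- exact: mE.
- move: aeA Zae; apply: filterS2 => w Aw /(_ I)/= [] Zw _ /=.
  by rewrite ZW.
Qed.

End BoundedExpectation.

(** * ETS and mFSR of a selection rule in terms of scores *)

Section SelectionRules.
Context d (T : measurableType d) (R : realType) (P : probability T R) (p n : nat).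
Variables (X : 'I_n -> {RV P >-> p.-tuple R}) (Y : 'I_n -> {RV P >-> nat}).
Variable S : nat -> {mfun p.-tuple R >-> R}.
Hypothesis indep : mutually_independent P (fun j w => (X j w, Y j w)).
Hypothesis oracle : forall j, is_oracle_score (X j) (Y j) S.
Hypothesis Yclass : forall j w, is_class (Y j w).
Implicit Types delta : rule R p n.

Let predicts delta k j w : R := (prediction X delta j w == k)%:R.

(** For a rule with values in {0, 1, 2} this is the indicator of a nonzero prediction; the splitting
    by class runs parallel to [selected_score]. *)
Definition selected delta j w : R := predicts delta 1%N j w + predicts delta 2%N j w.

(* The conditional probability, given the features, that sample [j] is selected
   and correctly classified. *)
Definition selected_score delta j w : R :=
  predicts delta 1%N j w * S 1%N (X j w) + predicts delta 2%N j w * S 2%N (X j w).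

Definition expected_selections delta : R :=
  Exp P (fun w => \sum_(j < n) selected delta j w).

Let hit delta j w : R :=
  predicts delta 1%N j w * (Y j w == 1%N)%:R + predicts delta 2%N j w * (Y j w == 2%N)%:R.

Let XT w := [tuple X i w | i < n].

Let mXT : measurable_fun setT XT.
Proof.
apply/measurable_fun_tnthP => i.
rewrite (_ : _ \o _ = X i)//; apply/funext => w; exact: tnth_mktuple.
Qed.

Lemma score_ge0 j k w : is_class k -> 0 <= S k (X j w).
Proof. by move=> kc; exact: (oracle_score_ge0 (oracle j)). Qed.

Lemma score_le1 j k w : is_class k -> S k (X j w) <= 1.
Proof.
have := oracle_score_sum (oracle j) (X j w).
have := @score_ge0 j 1%N w isT; have := @score_ge0 j 2%N w isT.
by move=> h2 h1 h; case/orP => /eqP ->; lra.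
Qed.

Let bounded_score j k : is_class k ->
  bounded_measurable (fun w => S k (X j w)).
Proof.
move=> kc; split; first exact: measurableT_comp.
by exists 1 => w; rewrite ger0_norm ?score_ge0 ?score_le1.
Qed.

Let measurable_predicts delta k j : selection_rule delta ->
  measurable (XT @^-1` (delta j @^-1` [set k])).
Proof.
move=> sd; rewrite -[X in measurable X]setTI; apply: mXT => //.
rewrite -[X in measurable X]setTI; apply: (sd j).1 => //.
Qed.

Let predictsE delta k j :
  predicts delta k j = \1_(XT @^-1` (delta j @^-1` [set k])).
Proof.
by apply/funext => w; rewrite /predicts indicE; congr ((nat_of_bool _)%:R);
  apply/eqP/idP; rewrite inE.
Qed.

Let bounded_predicts delta k j : selection_rule delta ->
  bounded_measurable (predicts delta k j).
Proof.
move=> sd; rewrite predictsE; apply: bounded_measurable_indic.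
exact: measurable_predicts.
Qed.

Let classE k j : (fun w => (Y j w == k)%:R) = \1_(Y j @^-1` [set k]) :> (T -> R).
Proof.
by apply/funext => w; rewrite indicE; congr ((nat_of_bool _)%:R);
  apply/eqP/idP; rewrite inE.
Qed.

Let bounded_class k j : bounded_measurable (fun w => (Y j w == k)%:R : R).
Proof.
rewrite classE; apply: bounded_measurable_indic.
exact: measurable_funPTI.
Qed.

Let bounded_selected delta j : selection_rule delta ->
  bounded_measurable (selected delta j).
Proof. by move=> sd; apply: bounded_measurableD; exact: bounded_predicts. Qed.

Let bounded_selected_score delta j : selection_rule delta ->
  bounded_measurable (selected_score delta j).
Proof.
by move=> sd; apply: bounded_measurableD; apply: bounded_measurableM;
  (exact: bounded_predicts || exact: bounded_score).
Qed.

Let bounded_hit delta j : selection_rule delta ->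
  bounded_measurable (hit delta j).
Proof.
by move=> sd; apply: bounded_measurableD; apply: bounded_measurableM => //;
  exact: bounded_predicts.
Qed.

(** Predicting [k] for sample [j] is an event about the features of all samples, so [joint_score]
    applies to it. *)
Lemma Exp_hit_class delta k j : selection_rule delta -> is_class k ->
  Exp P (fun w => predicts delta k j w * (Y j w == k)%:R) =
  Exp P (fun w => predicts delta k j w * S k (X j w)).
Proof.
move=> sd kc; rewrite !ExpE; congr fine.
have mA := measurable_predicts k j sd.
set A := XT @^-1` _ in mA.
have mY : measurable (Y j @^-1` [set k]).
  exact: measurable_funPTI.
have [S_ge0 _ SE] := oracle j.
transitivity (P (A `&` Y j @^-1` [set k])).
  rewrite -[in RHS](setIT (A `&` _)) -integral_indic//; last exact: measurableI.
  apply: eq_integral => w _; rewrite indicI /= predictsE.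
  by rewrite -[X in _ * X]/((fun w => (Y j w == k)%:R) w) classE.
rewrite (@joint_score _ _ _ _ _ _ _ X Y indep j k (S k))//; last 3 first.
- by move=> x; exact: S_ge0.
- by move=> B mB; exact: SE.
- by rewrite -[X in measurable X]setTI; exact: (sd j).1.
rewrite [in LHS]integral_mkcond; apply: eq_integral => w _.
by rewrite predictsE indicE patchE -/A; case: ifPn => wA; rewrite ?mul1r ?mul0r.
Qed.

Let ETS_hit delta :
  ETS X Y delta = Exp P (fun w => \sum_(j < n) hit delta j w).
Proof.
congr Exp; apply/funext => w; apply: eq_bigr => j _; rewrite /hit /predicts.
have /orP[/eqP->|/eqP->] := Yclass j w;
  by case: (prediction _ _ _ _) => [|[|[|k]]]; rewrite /= ?mulr0 ?mulr1 ?addr0 ?add0r.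
Qed.

Lemma ETSE delta : selection_rule delta ->
  ETS X Y delta = Exp P (fun w => \sum_(j < n) selected_score delta j w).
Proof.
move=> sd; rewrite ETS_hit !Exp_sum => [|j|j]; [|exact: bounded_selected_score|exact: bounded_hit].
apply: eq_bigr => j _; rewrite /hit /selected_score !ExpD ?Exp_hit_class//.
all: by apply: bounded_measurableM => //; (exact: bounded_predicts || exact: bounded_score).
Qed.

(** Pointwise, a false selection is a selection minus a correct one. *)
Lemma mFSRE delta : selection_rule delta ->
  mFSR X Y delta =
  (expected_selections delta - ETS X Y delta) / expected_selections delta.
Proof.
move=> sd; rewrite /mFSR.
have sel j w : (prediction X delta j w != 0%N)%:R = selected delta j w.
  rewrite /selected /predicts; have : (prediction X delta j w <= 2)%N := (sd j).2 _.
  by case: (prediction _ _ _ _) => [|[|[|k]]]//=; rewrite ?addr0 ?add0r.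
congr (_ / _); last first.
  by congr Exp; apply/funext => w; apply: eq_bigr => j _.
rewrite ETS_hit -ExpB; last 2 first.
- by apply: bounded_measurable_sum => j; exact: bounded_selected.
- by apply: bounded_measurable_sum => j; exact: bounded_hit.
congr Exp; apply/funext => w; rewrite -sumrB; apply: eq_bigr => j _.
rewrite -sel /hit /predicts.
have : (prediction X delta j w <= 2)%N := (sd j).2 _.
have /orP[/eqP->|/eqP->] := Yclass j w;
  by case: (prediction _ _ _ _) => [|[|[|k]]]//= _;
    rewrite ?mulr0 ?mulr1 ?addr0 ?add0r ?oppr0 ?addr0 ?subrr.
Qed.

Lemma selected_score_le delta j w : selected_score delta j w <= selected delta j w.
Proof. by rewrite lerD// ler_piMr// score_le1. Qed.

Lemma ETS_ge0 delta : 0 <= ETS X Y delta.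
Proof. by rewrite Exp_ge0// => w; rewrite sumr_ge0. Qed.

Lemma ETS_le_expected_selections delta : selection_rule delta ->
  ETS X Y delta <= expected_selections delta.
Proof.
move=> sd; rewrite ETSE// le_Exp//.
- by apply: bounded_measurable_sum => j; exact: bounded_selected_score.
- by apply: bounded_measurable_sum => j; exact: bounded_selected.
- by move=> w; rewrite ler_sum// => j _; exact: selected_score_le.
Qed.

Let ExpB_selected delta c : selection_rule delta ->
  Exp P (fun w => \sum_(j < n) (selected_score delta j w - c * selected delta j w)) =
  ETS X Y delta - c * expected_selections delta.
Proof.
move=> sd; rewrite ETSE// -ExpZ -?ExpB; last 3 first.
- by apply: bounded_measurable_sum => j; exact: bounded_selected_score.
- apply: bounded_measurableM; first exact: bounded_measurable_cst.
  by apply: bounded_measurable_sum => j; exact: bounded_selected.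
- by apply: bounded_measurable_sum => j; exact: bounded_selected.
by congr Exp; apply/funext => w; rewrite sumrB mulr_sumr.
Qed.

Let bounded_score_gap delta c j : selection_rule delta ->
  bounded_measurable (fun w => selected_score delta j w - c * selected delta j w).
Proof.
move=> sd; apply: bounded_measurableB; first exact: bounded_selected_score.
by apply: bounded_measurableM; [exact: bounded_measurable_cst|exact: bounded_selected].
Qed.

(* A rule all of whose selected samples have the same score [c] almost never
   selects. *)
Lemma expected_selections_eq0 delta c : selection_rule delta ->
  (forall j k, is_class k -> P ((S k \o X j) @^-1` [set c]) = 0%E) ->
  Exp P (fun w => \sum_(j < n) `|selected_score delta j w - c * selected delta j w|) <= 0 ->
  expected_selections delta = 0.
Proof.
move=> sd atomless.
(* Almost surely no score equals [c]; on this event a selected sample has a nonzero gap, so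
   vanishing gaps mean that nothing is selected. *)
pose A := [set w | forall j, S 1%N (X j w) != c /\ S 2%N (X j w) != c].
move=> H; apply: (Exp_eq0 (A := A) _ _ _ H).
- by apply: bounded_measurable_sum => j; apply: bounded_measurable_norm; exact: bounded_score_gap.
- by apply: bounded_measurable_sum => j; exact: bounded_selected.
- by move=> w; rewrite sumr_ge0.
- have aeC k j : is_class k -> {ae P, forall w, S k (X j w) != c}.
    move=> kc; exists ((S k \o X j) @^-1` [set c]); split.
    + by exact: (measurable_funPTI (S k \o X j : {RV P >-> R})).
    + exact: atomless.
    + by move=> w /= /negP; rewrite negbK => /eqP.
  apply: filter_forall => j.
  by move: (aeC 1%N j isT) (aeC 2%N j isT); apply: filterS2.
- move=> w Aw /eqP; rewrite psumr_eq0// => /allP gap0.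
  rewrite big1// => j _; have := gap0 j (mem_index_enum _).
  rewrite /= normr_eq0 /selected_score /selected /predicts; have [n1 n2] := Aw j.
  case: (prediction _ _ _ _) => [|[|[|k]]] /=;
    rewrite ?mul1r ?mul0r ?addr0 ?add0r ?mulr1 ?subr_eq0 //.
  + by rewrite (negbTE n1).
  + by rewrite (negbTE n2).
Qed.

(** * The oracle rule with threshold [t] *)

Variable t : R.
Let oracle_t := oracle_rule S t : rule R p n.
Let above j w : R := (t <= max_score S (X j w))%R%:R.

Lemma oracle_rule_selection : selection_rule oracle_t.
Proof.
move=> j; split; last first.
  by move=> x; rewrite /oracle_t /oracle_rule /argmax_class; case: (t <= _); case: ifP.
have mS k : measurable_fun setT (fun x : n.-tuple (p.-tuple R) => S k (tnth x j)).
  by apply: measurableT_comp => //; exact: measurable_tnth.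
have mM : measurable_fun setT (fun x : n.-tuple (p.-tuple R) => max_score S (tnth x j)).
  exact: measurable_maxr.
rewrite (_ : oracle_t j = fun x => if t <= max_score S (tnth x j) then
    if S 2%N (tnth x j) <= S 1%N (tnth x j) then 1%N else 2%N else 0%N); last first.
  by apply/funext => x; rewrite /oracle_t /oracle_rule /argmax_class; case: (t <= _); case: ifP.
apply: measurable_fun_ifT => //; first exact: measurable_fun_ler.
by apply: measurable_fun_ifT => //; exact: measurable_fun_ler.
Qed.

Let predicts_oracle k j w : predicts oracle_t k j w =
  ((argmax_class S (X j w) * (t <= max_score S (X j w))%R)%N == k)%:R.
Proof. by rewrite /predicts /prediction /oracle_t /oracle_rule tnth_mktuple. Qed.

Lemma oracle_selected j w : selected oracle_t j w = above j w.
Proof.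
rewrite /selected !predicts_oracle /argmax_class /above.
by case: (t <= _); case: ifP; rewrite /= ?addr0 ?add0r.
Qed.

Lemma oracle_selected_score j w :
  selected_score oracle_t j w = max_score S (X j w) * above j w.
Proof.
rewrite /selected_score !predicts_oracle /argmax_class /above /max_score.
by case: leP; case: (t <= _); rewrite /= ?mulr0 ?mulr1 ?mul1r ?mul0r ?addr0 ?add0r.
Qed.

Lemma QE : Q X S t =
  (expected_selections oracle_t - ETS X Y oracle_t) / expected_selections oracle_t.
Proof.
have ot := oracle_rule_selection.
rewrite /Q; congr (_ / _); last first.
  by congr Exp; apply/funext => w; apply: eq_bigr => j _; rewrite oracle_selected.
rewrite ETSE// -ExpB; last 2 first.
- by apply: bounded_measurable_sum => j; exact: bounded_selected.
- by apply: bounded_measurable_sum => j; exact: bounded_selected_score.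
congr Exp; apply/funext => w; rewrite -sumrB; apply: eq_bigr => j _.
by rewrite oracle_selected oracle_selected_score mulrBl mul1r.
Qed.

(** A prediction [k] contributes S k - t and an indecision contributes 0; the oracle attains the
    largest of these, the positive part of [max_score] minus [t]. *)
Lemma selected_score_le_oracle delta j w : selection_rule delta ->
  selected_score delta j w - t * selected delta j w <=
  selected_score oracle_t j w - t * selected oracle_t j w.
Proof.
move=> sd; rewrite oracle_selected oracle_selected_score /above -mulrBl.
have gain : 0 <= (max_score S (X j w) - t) * (t <= max_score S (X j w))%R%:R.
  by case: (leP t (max_score S (X j w))) => h; rewrite ?mulr0// mulr1 subr_ge0.
have gain' : max_score S (X j w) - t <=
    (max_score S (X j w) - t) * (t <= max_score S (X j w))%R%:R.
  by case: (leP t (max_score S (X j w))) => h; rewrite ?mulr0 ?mulr1// subr_le0 ltW.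
have S1 : S 1%N (X j w) <= max_score S (X j w) by rewrite le_max lexx.
have S2 : S 2%N (X j w) <= max_score S (X j w) by rewrite le_max lexx orbT.
rewrite /selected_score /selected /predicts.
by case: (prediction _ _ _ _) => [|[|[|k]]] /=;
  rewrite ?(mul1r, mul0r, addr0, add0r, mulr1, mulr0, oppr0)//;
  apply: le_trans gain'; rewrite lerD2r.
Qed.

Lemma oracle_score_gap_ge0 j w :
  0 <= selected_score oracle_t j w - t * selected oracle_t j w.
Proof.
rewrite oracle_selected oracle_selected_score /above -mulrBl.
by case: (leP t (max_score S (X j w))) => h; rewrite ?mulr0// mulr1 subr_ge0.
Qed.

(** * Optimality of the oracle rule *)

Hypothesis atomless :
  forall c j k, is_class k -> P ((S k \o X j) @^-1` [set c]) = 0%E.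

Lemma oracle_rule_optimal delta : D X Y (Q X S t) delta ->
  ETS X Y delta <= ETS X Y oracle_t.
Proof.
move=> [sd]; rewrite mFSRE// QE.
have ot := oracle_rule_selection.
have gapD : ETS X Y delta - t * expected_selections delta <=
    ETS X Y oracle_t - t * expected_selections oracle_t.
  rewrite -!ExpB_selected//; apply: le_Exp.
  - by apply: bounded_measurable_sum => j; exact: bounded_score_gap.
  - by apply: bounded_measurable_sum => j; exact: bounded_score_gap.
  - by move=> w; rewrite ler_sum// => j _; exact: selected_score_le_oracle.
have gapO : 0 <= ETS X Y oracle_t - t * expected_selections oracle_t.
  rewrite -ExpB_selected// Exp_ge0// => w.
  by rewrite sumr_ge0// => j _; exact: oracle_score_gap_ge0.
have [t_le0|t_gt0] := leP t 0.
  move=> _; rewrite !ETSE//; apply: le_Exp.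
  - by apply: bounded_measurable_sum => j; exact: bounded_selected_score.
  - by apply: bounded_measurable_sum => j; exact: bounded_selected_score.
  move=> w; rewrite ler_sum// => j _.
  have S1_ge0 := @score_ge0 j 1%N w isT.
  have M_ge0 : 0 <= max_score S (X j w) by rewrite le_max S1_ge0.
  rewrite oracle_selected_score /above (le_trans t_le0 M_ge0) mulr1.
  rewrite /selected_score /predicts.
  by case: (prediction _ _ _ _) => [|[|[|k]]] /=;
    rewrite ?mul1r ?mul0r ?addr0 ?add0r// le_max lexx ?orbT.
have E0 := ETS_ge0 delta; have EN := ETS_le_expected_selections sd.
have EO0 := ETS_ge0 oracle_t; have EON := ETS_le_expected_selections ot.
set E := ETS X Y delta in gapD E0 EN *; set N := expected_selections delta in gapD EN *.
set EO := ETS X Y oracle_t in gapD gapO EO0 EON *.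
set NO := expected_selections oracle_t in gapD gapO EON *.
(* If N = 0 the quotient is 0 by convention, but then E = 0 as well and the conclusion is
   trivial. *)
have mFSR_le a : (N - E) / N <= a -> N - E <= a * N.
  have [N0|N_neq0] := eqVneq N 0; first by move: E0 EN; rewrite N0; lra.
  by rewrite ler_pdivrMr// lt_neqAle eq_sym N_neq0 (le_trans E0 EN).
have [NO0|NO_neq0] := eqVneq NO 0.
  (* Here Q(t) = 0 by the convention on division, so [NE] gives E = N. *)
  rewrite NO0 invr0 mulr0 => /mFSR_le; rewrite mul0r => NE.
  suff -> : E = 0 by [].
  (* For t < 1, [gapD] with EO = NO = 0 reads (1 - t) E <= 0. *)
  have [t_lt1|t_ge1] := ltP t 1; first by nra.
  (* Scores are at most 1, so the absolute gaps to c = 1 have total expectation N - E <= 0. *)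
  have N0 : N = 0.
    apply: (expected_selections_eq0 (c := 1) sd) => //; first exact: atomless.
    rewrite (_ : (fun w => _) = fun w => -1 *
        \sum_(j < n) (selected_score delta j w - 1 * selected delta j w)); last first.
      apply/funext => w; rewrite mulN1r -sumrN; apply: eq_bigr => j _.
      by rewrite ler0_norm// mul1r subr_le0 selected_score_le.
    rewrite ExpZ; last by apply: bounded_measurable_sum => j; exact: bounded_score_gap.
    rewrite ExpB_selected// -/E -/N; lra.
  lra.
have NO_gt0 : 0 < NO by rewrite lt_neqAle eq_sym NO_neq0 (le_trans EO0 EON).
set a := (NO - EO) / NO => /mFSR_le NE.
have EOE : EO = (1 - a) * NO by rewrite /a; field.
have at_le : t <= 1 - a by rewrite -(ler_pM2r NO_gt0) -EOE -subr_ge0.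
(* Equality would give the nonnegative oracle gaps expectation EO - t NO = 0, so all selected scores
   would be [t] almost surely. *)
have at_neq : t != 1 - a.
  apply/eqP => ta; move/eqP : NO_neq0; apply.
  apply: (expected_selections_eq0 (c := t) ot) => //; first exact: atomless.
  under eq_fun do under eq_bigr do rewrite ger0_norm ?oracle_score_gap_ge0//.
  by rewrite ExpB_selected// -/EO -/NO EOE -ta subrr.
have at_lt : 0 < 1 - a - t by rewrite subr_gt0 lt_neqAle at_neq.
(* Multiply [gapD] by 1 - a, which is at least t > 0. On the left use (1 - a) N <= E, on the right
   (1 - a) NO = EO. *)
rewrite -(ler_pM2l at_lt).
nra.
Qed.

End SelectionRules.

Theorem theorem1 (d : measure_display) (T : measurableType d) (R : realType)
  (P : probability T R) (p n_test n_cal : nat)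
  (X : 'I_n_test -> {RV P >-> p.-tuple R})
  (Y : 'I_n_test -> {RV P >-> nat})
  (Xcal : 'I_n_cal -> {RV P >-> p.-tuple R})
  (Ycal : 'I_n_cal -> {RV P >-> nat})
  (S : nat -> {mfun p.-tuple R >-> R})
  (pi_test pi_cal : R) (F f : nat -> nat -> R -> R) (alpha t : R)
  (indep_test : mutually_independent P (fun j w => (X j w, Y j w)))
  (oracle_test : forall j, is_oracle_score (X j) (Y j) S)
  (mixture_test : forall j, follows_mixture (X j) (Y j) S pi_test F)
  (mixture_cal : forall j, follows_mixture (Xcal j) (Ycal j) S pi_cal F)
  (density : forall i k, is_class i -> is_class k -> has_density (F i k) (f i k))
  (Qt : Q X S t = alpha) :
  forall delta : rule R p n_test,
    D X Y alpha delta -> ETS X Y delta <= ETS X Y (oracle_rule S t).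
Proof.
move=> delta; rewrite -Qt; apply: oracle_rule_optimal => //.
- by move=> j w; exact: (mixture_class (mixture_test j)).
- by move=> c j k kc; exact: score_atomless (mixture_test j) density _ _ kc.
Qed.
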